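(* The monoid $U_2(\mathbb{T})$ of upper triangular $2\times 2$ tropical matrices satisfies the semigroup identity $$AB^2A\; AB\; AB^2A \;=\; AB^2A\; BA\; AB^2A ,$$ i.e. this equality holds for all $A,B\in U_2(\mathbb{T})$.
   Context: The tropical semiring is $\mathbb{T}=\mathbb{R}\cup\{-\infty\}$ with addition $a\oplus b=\max\{a,b\}$ and multiplication $a\odot b=a+b$ (with $-\infty$ absorbing for $\odot$). $M_2(\mathbb{T})$ is the monoid of $2\times 2$ matrices over $\mathbb{T}$, with matrix multiplication induced by $\oplus,\odot$. $U_2(\mathbb{T})\subset M_2(\mathbb{T})$ is the submonoid of upper triangular matrices, i.e. those whose $(2,1)$ entry is $-\infty$ (the zero of $\mathbb{T}$). A semigroup satisfies a semigroup identity $u=v$ if the equality holds under every substitution of semigroup elements for the letters. *)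

(* Defs.v *)
From HB Require Import structures.
From mathcomp Require Import all_boot all_order all_algebra.
From mathcomp Require Import reals.

Set Implicit Arguments.
Unset Strict Implicit.
Unset Printing Implicit Defensive.

Import Order.TTheory GRing.Theory Num.Theory.

Local Open Scope ring_scope.

(* [None] is the element -oo. *)
Definition tropical (R : Type) : Type := option R.

HB.instance Definition _ (R : choiceType) := Choice.on (tropical R).

Section TropicalSemiring.
Context {R : realDomainType}.
Implicit Types a b c : tropical R.

Definition trop_add a b : tropical R :=
  match a, b with
  | Some x, Some y => Some (Num.max x y)
  | None, _ => b
  | _, None => a
  end.

Definition trop_mul a b : tropical R :=
  match a, b with
  | Some x, Some y => Some (x + y)
  | _, _ => None
  end.

Fact trop_addA : associative trop_add.
Proof. by case=> [x|] [y|] [z|] //=; rewrite maxA. Qed.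

Fact trop_addC : commutative trop_add.
Proof. by case=> [x|] [y|] //=; rewrite maxC. Qed.

Fact trop_add0 : left_id None trop_add.
Proof. by case. Qed.

Fact trop_mulA : associative trop_mul.
Proof. by case=> [x|] [y|] [z|] //=; rewrite addrA. Qed.

Fact trop_mulC : commutative trop_mul.
Proof. by case=> [x|] [y|] //=; rewrite addrC. Qed.

Fact trop_mul1 : left_id (Some 0) trop_mul.
Proof. by case=> [x|] //=; rewrite add0r. Qed.

Fact trop_mulDl : left_distributive trop_mul trop_add.
Proof. by case=> [x|] [y|] [z|] //=; rewrite addr_maxl. Qed.

Fact trop_mul0 : left_zero None trop_mul.
Proof. by []. Qed.

Fact trop_1_neq0 : (Some 0 : tropical R) != None.
Proof. by []. Qed.

End TropicalSemiring.

(* Hence, at type [tropical R], [+] is the maximum, [*] is the addition of R,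
   [0] is -oo and [1] is the real number zero. *)
HB.instance Definition _ (R : realDomainType) :=
  GRing.isNmodule.Build (tropical R) trop_addA trop_addC trop_add0.
HB.instance Definition _ (R : realDomainType) :=
  GRing.Nmodule_isComNzSemiRing.Build (tropical R)
    trop_mulA trop_mulC trop_mul1 trop_mulDl trop_mul0 trop_1_neq0.

(* Indices start at 0: [A 1 0] is the (2,1) entry. *)
Definition U2 (R : realDomainType) : {pred 'M[tropical R]_2} :=
  [pred A : 'M[tropical R]_2 | A 1 0 == 0].

Fact U2_mulr_closed (R : realDomainType) : mulr_closed (@U2 R).
Proof.
split=> [|A B]; first by rewrite inE mxE.
rewrite !inE => /eqP A10 /eqP B10.
have e1 : lift ord0 ord0 = 1 :> 'I_2 by apply: val_inj.
by rewrite mxE big_ord_recl big_ord1 e1 A10 B10 mul0r mulr0 addr0.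
Qed.

HB.instance Definition _ (R : realDomainType) :=
  GRing.isMulClosed.Build 'M[tropical R]_2 (@U2 R) (@U2_mulr_closed R).

(* Main.v *)
Require Import Defs.
From HB Require Import structures.
From mathcomp Require Import all_boot all_order all_algebra.
From mathcomp Require Import reals.
From mathcomp Require Import ring.

Import Order.TTheory GRing.Theory Num.Theory.

Local Open Scope ring_scope.

(** Put [P = A * B] and [Q = B * A].  Then [A * B ^+ 2 * A = P * Q], so the
    identity reads [P Q P P Q = P Q Q P Q].  Scalars commute, so the triangular
    matrices [P] and [Q] have the same diagonal, say [(x, y)]; let [u] and [v]
    be their upper right entries.  Both sides of the identity have diagonal
    [(x ^+ 5, y ^+ 5)], and only the upper right entries remain.  That of
    [P * Q] is [x * v + y * u], so for a middle factor with upper right entry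
    [w] the product has upper right entry
      [(x ^+ 3 + y ^+ 3) * (x * v + y * u) + x ^+ 2 * y ^+ 2 * w].
    The last term is the only one that depends on the middle factor, and for
    [w = u] as for [w = v] the maximum formed by the others absorbs it: the
    scalars are totally ordered, and [x ^+ 2 * y ^+ 2], the coefficient of [u],
    lies below [x ^+ 3 * y] if [y <= x] and below [y ^+ 4] if [x <= y]
    ([trop_absorb_sqr_mul]); for [v], exchange [x] and [y].
    Comparing products, where differences would be natural over the reals, keeps
    the argument uniform, with no separate treatment of -oo. *)

Lemma trop_add_selective (R : realDomainType) (x y : tropical R) :
  x + y = x \/ x + y = y.
Proof.
case: x y => [x|] [y|]; try by [left|right].
have [le_yx | /ltW le_xy] := leP y x; [left|right]; congr Some.
  exact: max_l.
exact: max_r.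
Qed.

(** As [s + t = t] means [s <= t], this says that [x ^+ 2 * y ^+ 2] is at most
    the maximum of the other two monomials. One of them alone is an upper bound,
    depending on which of [x] and [y] is larger. *)
Lemma trop_absorb_sqr_mul (R : realDomainType) (x y : tropical R) :
  x ^+ 2 * y ^+ 2 + (x ^+ 3 * y + y ^+ 4) = x ^+ 3 * y + y ^+ 4.
Proof.
have [xDy | xDy] := trop_add_selective _ x y.
  have -> : x ^+ 2 * y ^+ 2 + (x ^+ 3 * y + y ^+ 4) =
            x ^+ 2 * y * (x + y) + y ^+ 4 by ring.
  by rewrite xDy; ring.
(* Squaring is monotone: [x <= y] gives [x ^+ 2 <= x * y <= y ^+ 2]. *)
have sqrD : x ^+ 2 + y ^+ 2 = y ^+ 2.
  have sqr_y : y ^+ 2 = y * x + y ^+ 2 by rewrite !expr2 -{2}xDy mulrDr.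
  have mul_yx : y * x = x ^+ 2 + y * x by rewrite -{1}xDy; ring.
  by rewrite [in LHS]sqr_y addrA -mul_yx -sqr_y.
have -> : x ^+ 2 * y ^+ 2 + (x ^+ 3 * y + y ^+ 4) =
          x ^+ 3 * y + y ^+ 2 * (x ^+ 2 + y ^+ 2) by ring.
by rewrite sqrD; ring.
Qed.

Lemma mul_mx2E (S : nzSemiRingType) (A B : 'M[S]_2) i j :
  (A * B) i j = A i 0 * B 0 j + A i 1 * B 1 j.
Proof.
have lift1 : lift ord0 ord0 = 1 :> 'I_2 by apply: val_inj.
by rewrite mxE big_ord_recl big_ord1 lift1.
Qed.

Lemma U2_mul00 (R : realDomainType) (A B : 'M[tropical R]_2) :
  B \in @U2 R -> (A * B) 0 0 = A 0 0 * B 0 0.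
Proof. by rewrite inE => /eqP B10; rewrite mul_mx2E B10 mulr0 addr0. Qed.

Lemma U2_mul11 (R : realDomainType) (A B : 'M[tropical R]_2) :
  A \in @U2 R -> (A * B) 1 1 = A 1 1 * B 1 1.
Proof. by rewrite inE => /eqP A10; rewrite mul_mx2E A10 mul0r add0r. Qed.

Lemma U2_eqP (R : realDomainType) (A B : 'M[tropical R]_2) :
    A \in @U2 R -> B \in @U2 R ->
  A 0 0 = B 0 0 -> A 0 1 = B 0 1 -> A 1 1 = B 1 1 -> A = B.
Proof.
rewrite !inE => /eqP A10 /eqP B10 eq00 eq01 eq11; apply/matrixP.
have ord2E (i : 'I_2) : i = 0 \/ i = 1.
  by case: i => [[|[|i]] lti]; [left|right|]; try apply: val_inj.
by move=> i j; have [->|->] := ord2E i; have [->|->] := ord2E j;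
  rewrite ?A10 ?B10.
Qed.

Lemma U2_sandwich01 (R : realDomainType) (C M : 'M[tropical R]_2) :
    C \in @U2 R -> M \in @U2 R ->
  (C * M * C) 0 1 = C 0 0 * M 0 0 * C 0 1 + C 0 0 * M 0 1 * C 1 1
                    + C 0 1 * M 1 1 * C 1 1.
Proof. by move=> hC hM; rewrite mul_mx2E U2_mul00 // mul_mx2E; ring. Qed.

(** With the common diagonal [(x, y)], replacing [P] by [Q] as the middle factor
    changes only an upper right entry of weight [x ^+ 2 * y ^+ 2].  The entries that
    come from the two outer copies of [P * Q] have weights that are also of
    degree 4 in [x] and [y], but less balanced; one of them is at least
    [x ^+ 2 * y ^+ 2], whichever of [x] and [y] is larger. *)
Lemma U2_eq_diag_identity (R : realDomainType) (P Q : 'M[tropical R]_2) :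
    P \in @U2 R -> Q \in @U2 R -> P 0 0 = Q 0 0 -> P 1 1 = Q 1 1 ->
  P * Q * P * (P * Q) = P * Q * Q * (P * Q).
Proof.
move=> hP hQ eq00 eq11; have hPQ : P * Q \in @U2 R by rewrite rpredM.
apply: U2_eqP; rewrite ?rpredM //.
- by rewrite !U2_mul00 ?rpredM // eq00.
- rewrite !U2_sandwich01 // !U2_mul00 // !U2_mul11 // !mul_mx2E eq00 eq11.
  move: (P 0 1) (Q 0 1) (Q 0 0) (Q 1 1) => u v x y.
  (* The value of both sides: the middle entry has been absorbed. *)
  pose outer := (x ^+ 3 * y + y ^+ 4) * u + (y ^+ 3 * x + x ^+ 4) * v.
  transitivity outer; rewrite /outer.
    by rewrite -[in RHS](trop_absorb_sqr_mul _ x y); ring.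
  by rewrite -[in LHS](trop_absorb_sqr_mul _ y x); ring.
- by rewrite !U2_mul11 ?rpredM // eq11.
Qed.

Theorem theorem3p6 (R : realType) (A B : 'M[tropical R]_2)
    (hA : A \in @U2 R) (hB : B \in @U2 R) :
  (A * B ^+ 2 * A) * (A * B) * (A * B ^+ 2 * A) =
  (A * B ^+ 2 * A) * (B * A) * (A * B ^+ 2 * A).
Proof.
have -> : A * B ^+ 2 * A = (A * B) * (B * A) by rewrite expr2 !mulrA.
apply: U2_eq_diag_identity; rewrite ?rpredM //.
  by rewrite !U2_mul00 // mulrC.
by rewrite !U2_mul11 // mulrC.
Qed.
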